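(* Let $G$ and $H$ be finite groups and let $F\colon A(H)\to A(G)$ be a homomorphism of abelian groups. The map $\mathring{F}\colon\mathrm{Parks}(H,\mathbb{Q})\to\mathrm{Parks}(G,\mathbb{Q})$ is given, for $f\in\mathrm{Parks}(H,\mathbb{Q})$ and $\kappa\in\mathrm{Parts}(G)$, by \[\mathring{F}(f)(\kappa)=\sum_{\lambda\in\mathrm{Parts}(H)}\mathring{M}(F)^\kappa_\lambda f(\lambda)=\sum_{\substack{\lambda^\sharp=\kappa^\sharp\\ \lambda\in\mathrm{Parts}(H)}}\mathring{M}(F)^\kappa_\lambda f(\lambda),\] where \[\mathring{M}(F)^\kappa_\lambda=\sum_{\substack{\ell^\sharp=c(\kappa)^\sharp\\ \ell\in C(\lambda)}}\ \prod_i M(F)^{c(\kappa)_i^\flat}_{\ell_i^\flat}.\] Equivalently, \[\mathring{F}(f)(\kappa)=\sum_{\substack{\ell^\sharp=c(\kappa)^\sharp\\ \ell\in C(\mathrm{Conj}(H))}}f(u\ell)\prod_i M(F)^{c(\kappa)_i^\flat}_{\ell_i^\flat}.\]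
   Context: Burnside rings and marks. For a finite group $\Gamma$, $A(\Gamma)$ is the Burnside ring, with canonical $\mathbb{Z}$-basis the isomorphism classes of transitive $\Gamma$-sets; $\mathrm{Conj}(\Gamma)$ is the set of conjugacy classes of subgroups; $\mathrm{Marks}(\Gamma,R)=\mathrm{Fun}(\mathrm{Conj}(\Gamma),R)$ ($R=\mathbb{Z}$ if omitted); the marks homomorphism $\chi\colon A(\Gamma)\to\mathrm{Marks}(\Gamma)$, $\chi([X])([K])=|X^K|$, induces an isomorphism $\mathbb{Q}\otimes A(\Gamma)\cong\mathrm{Marks}(\Gamma,\mathbb{Q})$. Power operations. $\Gamma\wr\Sigma_n=\Gamma^{\times n}\rtimes\Sigma_n$ acts on $X^{\times n}$ for a $\Gamma$-set $X$. The transfer product $\star\colon A(\Gamma\wr\Sigma_i)\otimes A(\Gamma\wr\Sigma_j)\to A(\Gamma\wr\Sigma_{i+j})$ is $X\star Y=(\Gamma\wr\Sigma_{i+j})\times_{\Gamma\wr\Sigma_i\times\Gamma\wr\Sigma_j}(X\times Y)$. The total power operations $\mathbb{P}_n\colon A(\Gamma)\to A(\Gamma\wr\Sigma_n)$ are the unique functions with $\mathbb{P}_n([X])=[X^{\times n}]$, $\mathbb{P}_0=1$, $\mathbb{P}_n(x+y)=\sum_{i+j=n}\mathbb{P}_i(x)\star\mathbb{P}_j(y)$. $\mathring{A}(\Gamma,n)\subseteq A(\Gamma\wr\Sigma_n)$ is the summand spanned by the smallest subset of the canonical basis whose span contains the image of $\mathbb{P}_n$. $\mathring{A}(\Gamma)=\bigoplus_{n\ge0}\mathring{A}(\Gamma,n)$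 is a commutative graded ring under $\star$, polynomial on the generators $\mathbb{P}_n([\Gamma/K])$, $n>0$, $[K]\in\mathrm{Conj}(\Gamma)$. Decorated partitions. For a set $X$, an $X$-decorated partition is an element of the free commutative monoid $P(X)$ on $X\times\mathbb{N}_{>0}$, i.e. a finitely supported $\lambda\colon X\times\mathbb{N}_{>0}\to\mathbb{N}$, written $\sum\lambda_{x,m}\cdot(x,m)$; $\|\lambda\|=\sum\lambda_{x,m}m$, $|\lambda|=\sum\lambda_{x,m}$, $\lambda!=\prod\lambda_{x,m}!$; $\lambda^\sharp$ is the underlying integer partition, $\lambda^\sharp_m=\sum_x\lambda_{x,m}$. $\mathrm{Parts}(\Gamma)=P(\mathrm{Conj}(\Gamma))$ and $\mathrm{Parts}(\Gamma,n)=\{\lambda\in\mathrm{Parts}(\Gamma):\|\lambda\|=n\}$. Decorated compositions. $C(X)$ is the set of finite sequences $c=(c_1,\dots,c_k)$ of elements $c_i=(c_i^\flat,c_i^\sharp)\in X\times\mathbb{N}_{>0}$ ($c_i^\flat$ is the decoration, $c_i^\sharp$ the integer); $c^\sharp=(c_1^\sharp,\dots,c_k^\sharp)$; $uc=\sum_ic_i\in P(X)$. For $\lambda\in P(X)$, $C(\lambda)=\{c\in C(X):uc=\lambda\}$, and $c(\lambda)$ denotes an arbitrarily chosen element of $C(\lambda)$. The products over $i$ run over the common index set of $\ell$ and $c(\kappa)$; $\mathring{M}(F)^\kappa_\lambda$ does not depend on the choice of $c(\kappa)$. Parks. $\mathrm{Parks}(\Gamma,R)$ is the set of finitely supported functions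 $\mathrm{Parts}(\Gamma)\to R$, graded by size, a commutative graded ring under $(f\star g)(\mu)=\sum_{\kappa+\lambda=\mu}\frac{\mu!}{\kappa!\lambda!}f(\kappa)g(\lambda)$. The parks homomorphism $\chi\colon\mathring{A}(\Gamma)\to\mathrm{Parks}(\Gamma)$ is the unique graded ring homomorphism with $\chi(\mathbb{P}_n(x))(\lambda)=\prod_{[K],m}\chi(x)([K])^{\lambda_{[K],m}}$ for all $x\in A(\Gamma)$, $\lambda\in\mathrm{Parts}(\Gamma,n)$; it induces an isomorphism $\mathbb{Q}\otimes\mathring{A}(\Gamma)\cong\mathrm{Parks}(\Gamma,\mathbb{Q})$. Induced maps. $\mathring{F}\colon\mathring{A}(H)\to\mathring{A}(G)$ is the unique graded ring homomorphism (for $\star$) with $\mathring{F}(\mathbb{P}_n(x))=\mathbb{P}_n(F(x))$ for all $x\in A(H)$, $n\ge0$. Rationalizing via the isomorphisms above gives $F\colon\mathrm{Marks}(H,\mathbb{Q})\to\mathrm{Marks}(G,\mathbb{Q})$ and $\mathring{F}\colon\mathrm{Parks}(H,\mathbb{Q})\to\mathrm{Parks}(G,\mathbb{Q})$. The coefficients $M(F)^{[K]}_{[L]}\in\mathbb{Q}$ are defined by $F(f)([K])=\sum_{[L]\in\mathrm{Conj}(H)}M(F)^{[K]}_{[L]}f([L])$ for $f\in\mathrm{Marks}(H,\mathbb{Q})$, $[K]\in\mathrm{Conj}(G)$. *)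

(* Defs.v *)
From HB Require Import structures.
From mathcomp Require Import boolp classical_sets functions cardinality fsbigop.
From mathcomp Require Import finmap multiset monalg.
From mathcomp Require Import all_boot all_order all_algebra all_fingroup.

Set Implicit Arguments.
Unset Strict Implicit.
Unset Printing Implicit Defensive.

Import GRing.Theory Num.Theory GroupScope.

Local Open Scope ring_scope.

(* A finite Gamma-set is given, as usual in MathComp, by a total right action *)
(* to : {action gT &-> T} on a finType together with an invariant S : {set T}. *)

Section BurnsideRing.

Variable gT : finGroupType.

Definition Conj : Type :=
  {C : {set {group gT}} |
    C \in [set orbit 'JG%act [set: gT] K | K in [set: {group gT}]]}.

HB.instance Definition _ := Finite.on Conj.

Definition conj_repr (C : Conj) : {group gT} := odflt 1%G [pick K in val C].

(* The free abelian group on the transitive Gamma-sets; the class of          *)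
(* Gamma/K is the basis element indexed by the conjugacy class of K. Only the *)
(* additive structure of the Burnside ring, its unit and the classes of       *)
(* Gamma-sets are used below.                                                 *)
Definition Burnside : Type := {ffun Conj -> int}.

HB.instance Definition _ := GRing.Zmodule.on Burnside.

(* The coefficient at C is the number of orbits isomorphic to Gamma/K, K in C. *)
Definition gset_class (T : finType) (to : {action gT &-> T}) (S : {set T}) :
    Burnside :=
  [ffun C : Conj =>
     #|[set O in orbit to [set: gT] @: S |
         [exists x in O, 'C[x | to]%G \in val C]]|%:Z].

Definition triv_act (x : unit) (_ : gT) : unit := x.

Definition triv_action : {action gT &-> unit} :=
  TotalAction (to := triv_act) (fun=> erefl) (fun _ _ _ => erefl).

Definition Burnside1 : Burnside := gset_class triv_action [set: unit].

Definition Marks (R : nzRingType) : Type := {ffun Conj -> R^o}.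

HB.instance Definition _ (R : nzRingType) := GRing.Lmodule.on (Marks R).

(* The additive extension of [X] |-> ([K] |-> #|X^K|) from the canonical basis. *)
Definition marks (x : Burnside) : Marks int :=
  [ffun K : Conj =>
     \sum_(C : Conj)
        x C *+ #|'Fix_(rcosets (conj_repr C) [set: gT] | 'Rs)(conj_repr K)|].

Definition marksQ (x : Burnside) : Marks rat := [ffun K => (marks x K)%:~R].

End BurnsideRing.

Section WreathProduct.

Variables (gT : finGroupType) (n : nat).

(* Gamma wr Sigma_n. Permutations compose from left to right in MathComp, so  *)
(* (f, s) * (g, t) = (i |-> f i * g (s i), s * t), and the right action on X^n *)
(* sends x to the family whose (s i)-th member is x i . f i.                  *)
Record wreath := Wreath { wfun : {ffun 'I_n -> gT}; wperm : 'S_n }.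

Definition wreath_pair (w : wreath) := (wfun w, wperm w).
Definition pair_wreath p := Wreath p.1 p.2.

Lemma wreath_pairK : cancel wreath_pair pair_wreath.
Proof. by case. Qed.

HB.instance Definition _ := Finite.copy wreath (can_type wreath_pairK).

Definition wreath_mul (a b : wreath) : wreath :=
  Wreath [ffun i => (wfun a i * wfun b (wperm a i))%g] (wperm a * wperm b)%g.

Definition wreath_one : wreath := Wreath [ffun=> 1%g] 1%g.

Definition wreath_inv (a : wreath) : wreath :=
  Wreath [ffun i => (wfun a ((wperm a)^-1%g i))^-1%g] (wperm a)^-1%g.

Lemma wreath_mulA : associative wreath_mul.
Proof.
case=> [f s] [g t] [h u]; rewrite /wreath_mul /= mulgA; congr Wreath.
by apply/ffunP=> i; rewrite !ffunE permM mulgA.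
Qed.

Lemma wreath_mul1 : left_id wreath_one wreath_mul.
Proof.
case=> [f s]; rewrite /wreath_mul /= mul1g; congr Wreath.
by apply/ffunP=> i; rewrite !ffunE perm1 mul1g.
Qed.

Lemma wreath_mulV : left_inverse wreath_one wreath_inv wreath_mul.
Proof.
case=> [f s]; rewrite /wreath_mul /= mulVg; congr Wreath.
by apply/ffunP=> i; rewrite !ffunE mulVg.
Qed.

HB.instance Definition _ :=
  Finite_isGroup.Build wreath wreath_mulA wreath_mul1 wreath_mulV.

Lemma wfun1 i : wfun (1%g : wreath) i = 1%g.
Proof. by rewrite ffunE. Qed.

Lemma wperm1 : wperm (1%g : wreath) = 1%g.
Proof. by []. Qed.

Lemma wfunM (a b : wreath) i :
  wfun (a * b)%g i = (wfun a i * wfun b (wperm a i))%g.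
Proof. by rewrite ffunE. Qed.

Lemma wpermM (a b : wreath) : wperm (a * b)%g = (wperm a * wperm b)%g.
Proof. by []. Qed.

Section PowerAction.

Variables (T : finType) (to : {action gT &-> T}).

Definition pow_act (x : {ffun 'I_n -> T}) (w : wreath) : {ffun 'I_n -> T} :=
  [ffun j => to (x ((wperm w)^-1%g j)) (wfun w ((wperm w)^-1%g j))].

Lemma pow_act1 : pow_act^~ 1%g =1 id.
Proof.
by move=> x; apply/ffunP=> j; rewrite ffunE wfun1 act1 wperm1 invg1 perm1.
Qed.

Lemma pow_actM x : act_morph pow_act x.
Proof.
move=> a b; apply/ffunP=> j; rewrite ffunE wfunM.
by rewrite actM !ffunE wpermM invMg permM permKV.
Qed.

Definition pow_action : {action wreath &-> {ffun 'I_n -> T}} :=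
  TotalAction pow_act1 pow_actM.

Definition pow_set (S : {set T}) : {set {ffun 'I_n -> T}} :=
  [set x : {ffun 'I_n -> T} | [forall i, x i \in S]].

End PowerAction.

End WreathProduct.

Section TransferProduct.

Variables (gT : finGroupType) (i j n : nat) (e : (i + j)%N = n).

(* The inclusion of (Gamma wr Sigma_i) x (Gamma wr Sigma_j) in Gamma wr       *)
(* Sigma_n, the first factor acting on the first i indices.                   *)
Definition block_perm_fun (s : 'S_i) (t : 'S_j) (k : 'I_n) : 'I_n :=
  cast_ord e (match split (cast_ord (esym e) k) with
              | inl p => lshift j (s p)
              | inr q => rshift i (t q)
              end).

Lemma block_perm_inj s t : injective (block_perm_fun s t).
Proof.
apply: (can_inj (g := block_perm_fun s^-1%g t^-1%g)) => k.
rewrite /block_perm_fun cast_ordK; apply: (canLR (cast_ordKV e)).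
case: (split_ordP (cast_ord (esym e) k)) => [p ->|q ->].
  by rewrite (unsplitK (inl _)) permK.
by rewrite (unsplitK (inr _)) permK.
Qed.

Definition block (a : wreath gT i) (b : wreath gT j) : wreath gT n :=
  Wreath
    [ffun k => match split (cast_ord (esym e) k) with
               | inl p => wfun a p
               | inr q => wfun b q
               end]
    (perm (block_perm_inj (s := wperm a) (t := wperm b))).

Section TransferSet.

Variables (T1 T2 : finType).
Variables (to1 : {action wreath gT i &-> T1}) (to2 : {action wreath gT j &-> T2}).

Definition transfer_act (p : T1 * T2 * wreath gT n) (w : wreath gT n) :=
  (p.1, (p.2 * w)%g).

Lemma transfer_act1 : transfer_act^~ 1%g =1 id.
Proof. by case=> x w; rewrite /transfer_act mulg1. Qed.

Lemma transfer_actM p : act_morph transfer_act p.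
Proof. by move=> a b; rewrite /transfer_act mulgA. Qed.

Definition transfer_action := TotalAction transfer_act1 transfer_actM.

(* The induced set (S1 x S2) x_(Gamma wr Sigma_i x Gamma wr Sigma_j)          *)
(* (Gamma wr Sigma_n), an invariant set of equivalence classes.               *)
Definition transfer_pt (p : T1 * T2 * wreath gT n) :
    {set T1 * T2 * wreath gT n} :=
  [set (to1 p.1.1 u.1, to2 p.1.2 u.2, ((block u.1 u.2)^-1 * p.2)%g)
     | u : wreath gT i * wreath gT j].

Definition transfer_set (S1 : {set T1}) (S2 : {set T2}) :
    {set {set T1 * T2 * wreath gT n}} :=
  [set transfer_pt p | p : T1 * T2 * wreath gT n & p.1 \in setX S1 S2].

End TransferSet.

(* The biadditive extension of [X] * [Y] |-> [X star Y] from the canonical    *)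
(* basis.                                                                     *)
Definition star (a : Burnside (wreath gT i)) (b : Burnside (wreath gT j)) :
    Burnside (wreath gT n) :=
  \sum_(C : Conj (wreath gT i)) \sum_(D : Conj (wreath gT j))
    gset_class (transfer_action _ _)^*%act
      (transfer_set 'Rs%act 'Rs%act
         (rcosets (conj_repr C) [set: wreath gT i])
         (rcosets (conj_repr D) [set: wreath gT j])) *~ (a C * b D).

End TransferProduct.

Definition posnat : Type := {m : nat | (0 < m)%N}.

HB.instance Definition _ := Countable.on posnat.

(* X-decorated partitions, as multisets: the multiplicity of p : X * posnat in *)
(* l is l p, and their addition is msetD.                                     *)
Notation Part X := {mset (X * posnat)}%mset.

Notation Comp X := (seq (X * posnat)).

Section DecoratedPartitions.

Variable X : finType.

Implicit Types (l : Part X) (c : Comp X).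

Definition part_size l : nat := (\sum_(p <- finsupp l) l p * val p.2)%N.

Definition part_fact l : nat := (\prod_(p <- finsupp l) (l p)`!)%N.

(* The underlying integer partition, given by its multiplicities.             *)
Definition part_sharp l : posnat -> nat := fun m => (\sum_(x : X) l (x, m))%N.

Definition comp_sharp c : seq posnat := [seq p.2 | p <- c].

Definition comp_part c : Part X := seq_mset c.

End DecoratedPartitions.

Notation Parts gT := (Part (Conj gT)).

(* Finitely supported functions Parts gT -> R; the value of f at l is f@_l.   *)
Notation Parks gT R := {malg R[Parts gT]}.

Section Parks.

Variable gT : finGroupType.

Definition parks_star (R : nzRingType) (f g : Parks gT R) (mu : Parts gT) : R :=
  \sum_(p \in [set p : Parts gT * Parts gT | msetD p.1 p.2 = mu]%classic)
    (part_fact mu %/ (part_fact p.1 * part_fact p.2))%:R * f@_(p.1) * g@_(p.2).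

Definition parksQ (f : Parks gT int) : Parks gT rat :=
  [malg mu in msupp f => (f@_mu)%:~R].

End Parks.

Section PowerOperations.

Variable gT : finGroupType.

Definition is_total_power
    (P : forall n, Burnside gT -> Burnside (wreath gT n)) : Prop :=
  [/\ forall n (T : finType) (to : {action gT &-> T}) (S : {set T}),
        [acts [set: gT], on S | to] ->
        P n (gset_class to S) = gset_class (pow_action n to) (pow_set n S),
      forall x, P 0%N x = Burnside1 (wreath gT 0) &
      forall n x y, P n (x + y) =
        \sum_(i < n.+1)
          star (subnKC (ltn_ord i : (i <= n)%N)) (P i x) (P (n - i)%N y)].

Variable P : forall n, Burnside gT -> Burnside (wreath gT n).

Definition in_span n (B : {set Conj (wreath gT n)}) (a : Burnside (wreath gT n)) :=
  forall C, a C != 0 -> C \in B.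

(* The summand Ar(Gamma, n): the span of the smallest set of basis elements *)
(* whose span contains the image of the n-th power operation.                 *)
Definition in_Aring n (a : Burnside (wreath gT n)) : Prop :=
  forall B, (forall x, in_span B (P n x)) -> in_span B a.

(* A graded homomorphism out of the direct sum of the Ar(Gamma, n) is given by *)
(* its homogeneous components; each component is a function on the whole of   *)
(* A(Gamma wr Sigma_n) of which only the values on Ar(Gamma, n) matter.    *)
Definition is_parks_hom (chi : forall n, Burnside (wreath gT n) -> Parks gT int) :
    Prop :=
  [/\ forall n a mu, in_Aring a -> (chi n a)@_mu != 0 -> part_size mu = n,
      forall n a b, in_Aring a -> in_Aring b -> chi n (a + b) = chi n a + chi n b,
      forall mu, (chi 0%N (Burnside1 (wreath gT 0)))@_mu = (mu == mset0)%:R,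
      forall i j n (e : (i + j)%N = n) a b mu, in_Aring a -> in_Aring b ->
        (chi n (star e a b))@_mu = parks_star (chi i a) (chi j b) mu &
      forall n x mu, part_size mu = n ->
        (chi n (P n x))@_mu = \prod_(p <- finsupp mu) marks x p.1 ^+ mu p].

End PowerOperations.

Section InducedMaps.

Variables (hT gT : finGroupType) (F : Burnside hT -> Burnside gT).
Variable PH : forall n, Burnside hT -> Burnside (wreath hT n).
Variable PG : forall n, Burnside gT -> Burnside (wreath gT n).

Definition is_induced_hom
    (Fo : forall n, Burnside (wreath hT n) -> Burnside (wreath gT n)) : Prop :=
  [/\ forall n a, in_Aring PH a -> in_Aring PG (Fo n a),
      forall n a b, in_Aring PH a -> in_Aring PH b -> Fo n (a + b) = Fo n a + Fo n b,
      Fo 0%N (Burnside1 (wreath hT 0)) = Burnside1 (wreath gT 0),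
      forall i j n (e : (i + j)%N = n) a b, in_Aring PH a -> in_Aring PH b ->
        Fo n (star e a b) = star e (Fo i a) (Fo j b) &
      forall n x, Fo n (PH n x) = PG n (F x)].

(* FM is the rationalization of F, Q (x) A(Gamma) being identified with       *)
(* Marks(Gamma, Q).                                                           *)
Definition is_marks_map (FM : Marks hT rat -> Marks gT rat) : Prop :=
  forall x, FM (marksQ x) = marksQ (F x).

Definition is_parks_map
    (Fo : forall n, Burnside (wreath hT n) -> Burnside (wreath gT n))
    (chiH : forall n, Burnside (wreath hT n) -> Parks hT int)
    (chiG : forall n, Burnside (wreath gT n) -> Parks gT int)
    (FP : Parks hT rat -> Parks gT rat) : Prop :=
  forall n a, in_Aring PH a ->
    FP (parksQ (chiH n a)) = parksQ (chiG n (Fo n a)).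

Definition is_marks_coef (FM : Marks hT rat -> Marks gT rat)
    (M : Conj gT -> Conj hT -> rat) : Prop :=
  forall f K, FM f K = \sum_(L : Conj hT) M K L * f L.

End InducedMaps.

Section ParksCoefficient.

Variables (hT gT : finGroupType) (M : Conj gT -> Conj hT -> rat).

(* Used only for c and l of the same length.                                  *)
Definition comp_coef (c : Comp (Conj gT)) (l : Comp (Conj hT)) : rat :=
  \prod_(p <- zip c l) M p.1.1 p.2.1.

Definition parks_coef (c : Comp (Conj gT)) (la : Parts hT) : rat :=
  \sum_(l \in [set l | comp_part l = la /\ comp_sharp l = comp_sharp c]%classic)
    comp_coef c l.

End ParksCoefficient.

(* Main.v *)
Require Import Defs.
From HB Require Import structures.
From mathcomp Require Import boolp classical_sets functions cardinality fsbigop.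
From mathcomp Require Import finmap multiset monalg.
From mathcomp Require Import all_boot all_order all_algebra all_fingroup.

Set Implicit Arguments.
Unset Strict Implicit.
Unset Printing Implicit Defensive.

Import Order.TTheory GRing.Theory Num.Theory GroupScope.

Local Open Scope ring_scope.

(** Both sides of each formula are linear in f, so the formulas may be tested on
    a spanning family of parks: the star products of total powers P_n(x).

    A park is evaluated at a decorated partition through a composition c that
    represents it. The coefficient mu! / (kappa! lambda!) in the star product
    counts the ways to deal the entries of c to two players so that they receive
    kappa and lambda, hence the star product turns into a sum over deals
    ([parks_star_deal]). The right-hand side of the theorem is the operator
    [recolour], which changes the decoration of every entry of c independently,
    with weights given by M. As it acts entry by entry it commutes with dealing
    ([recolour_deal]), that is, it is multiplicative; and on a total power the
    sum over recolourings factors ([recolour_prod]) as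
      prod_i sum_L M(c_i, L) chi(x)(L) = prod_i chi(F x)(c_i),
    the value of the total power of F x. So both sides agree on star products of
    total powers.

    It remains to see that such products lie in the summands on which the
    homomorphisms are prescribed, and that they span. For the first, only x with
    all P_n(x) nonnegative are used, such as the classes of actual sets. Then
    star (P_i x) (P_j y) is one of the nonnegative summands of P_(i+j)(x + y),
    so no cancellation can occur and its support is contained in the support of a
    total power ([subpower_star], [subpower_in_Aring]).

    For the second, the basis park supported at a sum of parts is a rational
    multiple of the star product of the basis parks at these parts
    ([power_span_cons]). The basis park at a single part (C, m) is reached from
    the park of P_m([Gamma/C]): apart from partitions into at least two, hence
    smaller, parts, its support consists of (C, m) and of some (K, m) where K is
    of smaller order than C, by triangularity of the table of marks
    ([power_span_one_part]). *)

(** * Dealing the entries of a composition to two players *)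

Section Deals.

Variable X : finType.

Implicit Types (c : Comp X) (mu nu : Part X).

(** The list keeps repetitions: two deals that give equal hands at different
    positions are counted separately. *)
Fixpoint deals c : seq (Comp X * Comp X) :=
  if c is q :: c' then
    [seq (q :: p.1, p.2) | p <- deals c'] ++
    [seq (p.1, q :: p.2) | p <- deals c']
  else [:: ([::], [::])].

Definition deal_parts (p : Comp X * Comp X) : Part X * Part X :=
  (comp_part p.1, comp_part p.2).

Lemma comp_part_cons (q : X * posnat) c :
  comp_part (q :: c) = msetD [mset q]%mset (comp_part c).
Proof. exact: mset_cons. Qed.

Lemma comp_part_nil : comp_part ([::] : Comp X) = mset0.
Proof. by apply/msetP => p; rewrite /comp_part mset_seqE mset0E. Qed.

Lemma part_enum mu : exists c, mu = comp_part c.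
Proof. by exists (enum_mset mu); rewrite /comp_part seq_mset_id. Qed.

Lemma comp_part1 (q : X * posnat) :
  comp_part [:: q] = [mset q]%mset.
Proof. by rewrite comp_part_cons comp_part_nil msetD0. Qed.

Lemma big_part (R : Type) (idx : R) (op : Monoid.com_law idx)
    (c : Comp X) (E : X * posnat -> R) :
  \big[op/idx]_(p <- finsupp (comp_part c))
     iterop (comp_part c p) op (E p) idx =
  \big[op/idx]_(p <- c) E p.
Proof.
rewrite -(perm_big _ (perm_undup_mset (comp_part c))).
rewrite -[RHS](perm_big _ (perm_eq_seq_mset c)) -[RHS]big_undup_iterop_count.
by apply: eq_bigr => p _; rewrite count_mem_mset.
Qed.

Lemma part_size_comp c :
  part_size (comp_part c) = (\sum_(p <- c) val p.2)%N.
Proof.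
rewrite /part_size -[RHS]big_part; apply: eq_bigr => p _.
by rewrite Monoid.iteropE iter_addn_0 mulnC.
Qed.

Lemma part_sharp_comp (d : Comp X) (m : posnat) :
  part_sharp (comp_part d) m = count_mem m (comp_sharp d).
Proof.
rewrite /part_sharp count_map -sum1_count.
under eq_bigr do rewrite /comp_part mset_seqE -sum1_count big_mkcond.
rewrite exchange_big [RHS]big_mkcond; apply: eq_bigr => -[y k] _ /=.
rewrite (bigD1 y) //= big1 ?addn0 => [|x neq]; last first.
  by rewrite xpair_eqE eq_sym (negPf neq).
by rewrite xpair_eqE eqxx.
Qed.

Lemma part_fact_cons (q : X * posnat) mu :
  part_fact (msetD [mset q]%mset mu) = ((mu q).+1 * part_fact mu)%N.
Proof.
pose A := (q |` finsupp mu)%fset.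
have factE nu : {subset finsupp nu <= A} ->
    part_fact nu = (\prod_(p <- A) (nu p)`!)%N.
  move=> sA; rewrite /part_fact; apply: big_fset_incl.
    exact/fsubsetP.
  by move=> p _; rewrite memNfinsupp => /eqP ->.
rewrite !factE; last 2 first.
- by move=> p pmu; rewrite /A in_fset1U pmu orbT.
- by move=> p; rewrite /A msuppE in_mset1D in_fset1U msuppE.
have qA : q \in A by rewrite /A fset1U1.
rewrite !(big_fsetD1 q qA) /= mulnA mset1DE eqxx add1n factS; congr muln.
by apply: eq_big_seq => p; rewrite in_fsetD1 mset1DE => /andP[/negPf ->].
Qed.

Lemma part_fact_gt0 mu : (0 < part_fact mu)%N.
Proof. by apply: prodn_gt0 => p; apply: fact_gt0. Qed.

Lemma mem_deals c p : p \in deals c ->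
  msetD (comp_part p.1) (comp_part p.2) = comp_part c.
Proof.
elim: c p => [|q c IHc] p /=.
  by rewrite inE => /eqP -> /=; rewrite comp_part_nil mset0D.
rewrite comp_part_cons mem_cat => /orP[] /mapP[r /IHc <- ->] /=;
  rewrite comp_part_cons.
  by rewrite msetDA.
by rewrite msetDCA.
Qed.

(** The multinomial coefficient mu! nu! * #deals = (mu + nu)!, by induction on
    the composition: the first entry q goes to one of the two players. If it
    goes to the first one, removing it divides mu! by mu q, and likewise for the
    second; the two factors add up to mu q + nu q, the multiplicity of q in the
    composition. *)
Lemma count_deals_parts c mu nu : msetD mu nu = comp_part c ->
  (count_mem (mu, nu) [seq deal_parts p | p <- deals c]
     * (part_fact mu * part_fact nu))%N = part_fact (comp_part c).
Proof.
elim: c mu nu => [|q c IHc] mu nu /=.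
  rewrite comp_part_nil => e.
  have mu0 : mu = mset0.
    apply/msetP => p; move/msetP/(_ p): e.
    by rewrite msetE2 mset0E; case: (mu p).
  have nu0 : nu = mset0 by rewrite -e mu0 mset0D.
  have f0 : part_fact (mset0 : Part X) = 1%N.
    by rewrite /part_fact big1 // => p _; rewrite mset0E.
  by rewrite /deal_parts /= comp_part_nil mu0 nu0 eqxx f0.
rewrite comp_part_cons => e; rewrite map_cat count_cat -!map_comp !count_map.
(* Prepending q to a hand shifts the hands that are counted, or makes the
   prescribed hand impossible if that hand does not contain q. *)
have cnt (A B : Part X) (f : Comp X * Comp X -> Comp X * Comp X) :
    (forall p, (deal_parts (f p) == (mu, nu)) = (deal_parts p == (A, B))) ->
    count (preim (deal_parts \o f) (pred1 (mu, nu))) (deals c) =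
    count_mem (A, B) [seq deal_parts p | p <- deals c].
  by move=> ef; rewrite count_map; apply: eq_count => p; rewrite /= ef.
have cnt0 (f : Comp X * Comp X -> Comp X * Comp X) :
    (forall p, (deal_parts (f p) == (mu, nu)) = false) ->
    count (preim (deal_parts \o f) (pred1 (mu, nu))) (deals c) = 0%N.
  move=> ef; apply/eqP; rewrite -leqn0 leqNgt -has_count.
  by apply/hasPn => p _ /=; rewrite ef.
have L : (count (preim (deal_parts \o (fun p => (q :: p.1, p.2)))
                       (pred1 (mu, nu))) (deals c)
            * (part_fact mu * part_fact nu)
          = mu q * part_fact (comp_part c))%N.
  have [qmu|qmu] := boolP (q \in mu).
    have emu := msetB1K qmu.
    rewrite (cnt (msetB mu [mset q]%mset) nu); last first.
      move=> p; rewrite /deal_parts !xpair_eqE /= comp_part_cons -{1}emu.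
      by congr (_ && _); apply/eqP/eqP => [/(can_inj (msetDKB _))|->].
    rewrite -(IHc (msetB mu [mset q]%mset) nu); last first.
      by apply: (can_inj (msetDKB [mset q]%mset)); rewrite msetDA emu e.
    rewrite -{2}emu part_fact_cons msetB1E eqxx subn1 prednK ?mset_gt0 //.
    by rewrite -!mulnA mulnCA.
  rewrite (mset_eq0P qmu) mul0n cnt0 // => p; apply/negP.
  rewrite /deal_parts xpair_eqE /= comp_part_cons => /andP[/eqP emu _].
  by rewrite -emu mset1D1 in qmu.
have R : (count (preim (deal_parts \o (fun p => (p.1, q :: p.2)))
                       (pred1 (mu, nu))) (deals c)
            * (part_fact mu * part_fact nu)
          = nu q * part_fact (comp_part c))%N.
  have [qnu|qnu] := boolP (q \in nu).
    have enu := msetB1K qnu.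
    rewrite (cnt mu (msetB nu [mset q]%mset)); last first.
      move=> p; rewrite /deal_parts !xpair_eqE /= comp_part_cons -{1}enu.
      by congr (_ && _); apply/eqP/eqP => [/(can_inj (msetDKB _))|->].
    rewrite -(IHc mu (msetB nu [mset q]%mset)); last first.
      by apply: (can_inj (msetDKB [mset q]%mset)); rewrite msetDCA enu e.
    rewrite -{2}enu part_fact_cons msetB1E eqxx subn1 prednK ?mset_gt0 //.
    by rewrite [(part_fact mu * _)%N]mulnCA mulnCA.
  rewrite (mset_eq0P qnu) mul0n cnt0 // => p; apply/negP.
  rewrite /deal_parts xpair_eqE /= comp_part_cons => /andP[_ /eqP enu].
  by rewrite -enu mset1D1 in qnu.
rewrite mulnDl part_fact_cons; apply: etrans (f_equal2 addn L R) _.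
rewrite -mulnDl; congr muln.
by move/msetP/(_ q): e; rewrite mset1DE eqxx msetE2 add1n.
Qed.

End Deals.

Lemma part_sharp_eq (X Y : finType) (d : Comp X) (e : Comp Y) :
  comp_sharp d = comp_sharp e ->
  part_sharp (comp_part d) = part_sharp (comp_part e).
Proof. by move=> eq_de; apply/funext => m; rewrite !part_sharp_comp eq_de. Qed.

Section DealProduct.

Variables (X : finType) (R : nzRingType).

Implicit Types (a b : Comp X -> R) (c : Comp X).

Definition deal_prod a b c : R := \sum_(p <- deals c) a p.1 * b p.2.

Lemma deal_prod_cons a b q c :
  deal_prod a b (q :: c) =
    deal_prod (a \o cons q) b c + deal_prod a (b \o cons q) c.
Proof. by rewrite /deal_prod big_cat !big_map. Qed.

Lemma eq_deal_prod a a' b b' : a =1 a' -> b =1 b' ->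
  deal_prod a b =1 deal_prod a' b'.
Proof. by move=> ea eb c; apply: eq_bigr => p _; rewrite ea eb. Qed.

End DealProduct.

(** The star product groups the deals of a composition by the pair of partitions
    that the two hands represent; [count_deals_parts] gives the group sizes. *)
Lemma parks_star_deal (gT : finGroupType) (R : nzRingType)
    (f g : Parks gT R) (c : Comp (Conj gT)) :
  parks_star f g (comp_part c) =
    deal_prod (fun d => f@_(comp_part d)) (fun d => g@_(comp_part d)) c.
Proof.
pose s := [seq deal_parts p | p <- deals c].
pose E (p : Parts gT * Parts gT) : R := f@_p.1 * g@_p.2.
transitivity (\sum_(p <- s) E p); last by rewrite big_map.
rewrite -big_undup_iterop_count /parks_star.
have mem_s p : (msetD p.1 p.2 = comp_part c) <-> (p \in undup s).
  rewrite mem_undup; split=> [e|/mapP[d /mem_deals <- ->] //].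
  rewrite -has_pred1 has_count lt0n; apply/eqP => cnt0.
  have := count_deals_parts e; rewrite -surjective_pairing cnt0 mul0n => /esym.
  by apply/eqP; rewrite -lt0n part_fact_gt0.
have -> : [set p : Parts gT * Parts gT | msetD p.1 p.2 = comp_part c]%classic =
          [set` undup s]%classic.
  by apply/seteqP; split=> p /= /mem_s.
rewrite -fsbig_seq ?undup_uniq //; apply: eq_big_seq => p /mem_s e.
have cnt := count_deals_parts e; rewrite -surjective_pairing in cnt.
rewrite -cnt mulnK ?muln_gt0 ?part_fact_gt0 // -mulrA mulr_natl.
by rewrite Monoid.iteropE /= -Monoid.iteropE.
Qed.

(** * Recolouring the entries of a composition *)

Section Recolouring.

Variables (X Y : finType) (R : comNzRingType) (M : Y -> X -> R).

Fixpoint colourings (s : seq posnat) : seq (Comp X) :=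
  if s is m :: s' then [seq (x, m) :: l | x <- enum X, l <- colourings s']
  else [:: [::]].

Lemma mem_colourings s l : (l \in colourings s) = (comp_sharp l == s).
Proof.
elim: s l => [|m s IHs] [|[x m'] l] //=.
  by apply/allpairsPdep => -[? [? []]].
apply/allpairsPdep/eqP => [[y [k [_ ks [_ -> ->]]]]|[-> e]].
  by move: ks; rewrite IHs => /eqP ->.
by exists x, l; rewrite mem_enum IHs e eqxx.
Qed.

Lemma colourings_uniq s : uniq (colourings s).
Proof.
elim: s => //= m s IHs; apply: allpairs_uniq; rewrite ?enum_uniq //.
by move=> [x l] [x' l'] _ _ /= [-> ->].
Qed.

Definition recolour (a : Comp X -> R) (c : Comp Y) : R :=
  \sum_(l <- colourings (comp_sharp c))
    a l * \prod_(p <- zip c l) M p.1.1 p.2.1.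

Lemma recolour_nil a : recolour a [::] = a [::].
Proof. by rewrite /recolour /= big_seq1 big_nil mulr1. Qed.

Lemma recolour_cons a y m c :
  recolour a ((y, m) :: c) =
    \sum_x M y x * recolour (a \o cons (x, m)) c.
Proof.
rewrite /recolour /= big_allpairs_dep big_enum /=; apply: eq_bigr => x _.
rewrite mulr_sumr; apply: eq_bigr => l _ /=.
by rewrite big_cons /= mulrCA.
Qed.

Lemma eq_recolour a b c : a =1 b -> recolour a c = recolour b c.
Proof. by move=> e; apply: eq_bigr => l _; rewrite e. Qed.

Lemma recolour_lin k a b c :
  recolour (fun l => k * a l + b l) c = k * recolour a c + recolour b c.
Proof.
rewrite /recolour mulr_sumr -big_split /=; apply: eq_bigr => l _.
by rewrite mulrDl mulrA.
Qed.

Lemma recolourD a b c :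
  recolour (fun l => a l + b l) c = recolour a c + recolour b c.
Proof.
rewrite -[recolour a c]mul1r -recolour_lin.
by apply: eq_recolour => l; rewrite mul1r.
Qed.

(** Recolouring and dealing commute because each entry is recoloured
    independently of the others and of the hand it is dealt to. *)
Lemma recolour_deal a b c :
  recolour (deal_prod a b) c = deal_prod (recolour a) (recolour b) c.
Proof.
elim: c a b => [|[y m] c IHc] a b.
  by rewrite recolour_nil /deal_prod /= !big_seq1 !recolour_nil.
(* Bilinearity of the deal product, in each argument in turn. *)
have deal_sum (f : X -> Comp Y -> R) (h : Comp Y -> R) :
    deal_prod (fun d => \sum_x M y x * f x d) h c =
      \sum_x M y x * deal_prod (f x) h c.
  under [RHS]eq_bigr do rewrite mulr_sumr.
  rewrite exchange_big; apply: eq_bigr => p _.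
  by rewrite mulr_suml; apply: eq_bigr => x _; rewrite mulrA.
have deal_sumr (f : X -> Comp Y -> R) (h : Comp Y -> R) :
    deal_prod h (fun d => \sum_x M y x * f x d) c =
      \sum_x M y x * deal_prod h (f x) c.
  under [RHS]eq_bigr do rewrite mulr_sumr.
  rewrite exchange_big; apply: eq_bigr => p _.
  by rewrite mulr_sumr; apply: eq_bigr => x _; rewrite mulrCA.
rewrite recolour_cons deal_prod_cons.
rewrite (eq_deal_prod (fun d => recolour_cons a y m d) (frefl _)) deal_sum.
rewrite (eq_deal_prod (frefl _) (fun d => recolour_cons b y m d)) deal_sumr.
rewrite -big_split; apply: eq_bigr => x _ /=.
rewrite -mulrDr -!IHc -recolourD; congr (_ * _); apply: eq_recolour => l.
exact: deal_prod_cons.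
Qed.

Lemma recolour_prod (phi : X -> R) c :
  recolour (fun l => \prod_(p <- l) phi p.1) c =
    \prod_(p <- c) \sum_x M p.1 x * phi x.
Proof.
elim: c => [|[y m] c IHc]; first by rewrite recolour_nil !big_nil.
rewrite recolour_cons big_cons -IHc mulr_suml; apply: eq_bigr => x _ /=.
rewrite -mulrA; congr (_ * _); rewrite /recolour mulr_sumr.
by apply: eq_bigr => l _; rewrite /= big_cons mulrA.
Qed.

End Recolouring.

(** * Transitive sets and the table of marks *)

Section Orbits.

Variable gT : finGroupType.

Implicit Types (C D : Conj gT) (K : {group gT}).

Lemma conj_class C : exists K, val C = orbit 'JG%act [set: gT] K.
Proof. by case: C => A /= /imsetP[K _ ->]; exists K. Qed.

Lemma conj_repr_in C : conj_repr C \in val C.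
Proof.
rewrite /conj_repr; case: pickP => [K|] //= none.
by have [K eC] := conj_class C; have := none K; rewrite eC orbit_refl.
Qed.

Lemma conj_repr_orbit C : val C = orbit 'JG%act [set: gT] (conj_repr C).
Proof.
have [K eC] := conj_class C; have := conj_repr_in C.
by rewrite eC => /orbit_eqP ->.
Qed.

Lemma conj_eq C D K : K \in val C -> K \in val D -> C = D.
Proof.
move=> KC KD; apply: val_inj.
move: KC KD; rewrite (conj_repr_orbit C) (conj_repr_orbit D).
by move=> /orbit_eqP <- /orbit_eqP <-.
Qed.

Lemma conj_card C K : K \in val C -> #|K| = #|conj_repr C|.
Proof. by rewrite conj_repr_orbit => /orbitP[x _ <-]; rewrite cardJg. Qed.

Definition delta C : Burnside gT := [ffun D => (D == C)%:R].

(** Without this, the abstract basis element indexed by C would not be known to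
    be the class of a set, and its total powers would not be known to be
    nonnegative. The set of cosets of K is a single orbit, and the stabilisers
    of its points are the conjugates of K. *)
Lemma coset_delta C :
  gset_class 'Rs%act (rcosets (conj_repr C) [set: gT]) = delta C.
Proof.
apply/ffunP => D; rewrite !ffunE.
set K := conj_repr C; rewrite -orbitRs.
have -> : orbit 'Rs%act [set: gT] @: orbit 'Rs%act [set: gT] (K : {set gT}) =
          [set orbit 'Rs%act [set: gT] (K : {set gT})].
  apply/setP => A; rewrite inE.
  apply/imsetP/eqP => [[B /orbit_eqP <- ->] //|->].
  by exists (K : {set gT}); rewrite ?orbit_refl.
have stab_in B : B \in orbit 'Rs%act [set: gT] (K : {set gT}) ->
    'C[B | 'Rs]%G \in val C.
  case/orbitP => x _ <-; rewrite conj_repr_orbit; apply/orbitP; exists x => //.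
  by apply: val_inj; rewrite /= astab1_act ?inE // astab1Rs.
have [->|neq] := eqVneq D C.
  rewrite (_ : finset _ = [set orbit 'Rs%act [set: gT] (K : {set gT})]);
    first by rewrite cards1.
  apply/setP => O; rewrite !inE andb_idr // => /eqP ->.
  apply/existsP; exists (K : {set gT}).
  by rewrite orbit_refl stab_in ?orbit_refl.
rewrite (_ : finset _ = finset.set0) ?cards0 //; apply/setP => O; rewrite !inE.
apply/negbTE/negP => /andP[/eqP -> /existsP[B /andP[KB BD]]].
by rewrite (conj_eq BD (stab_in B KB)) eqxx in neq.
Qed.

Lemma marks_delta C D :
  marks (delta C) D =
    #|'Fix_(rcosets (conj_repr C) [set: gT] | 'Rs)(conj_repr D)|%:Z.
Proof.
rewrite ffunE (bigD1 C) //= big1 => [|E /negPf neq]; last first.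
  by rewrite ffunE neq mul0rn.
by rewrite addr0 ffunE eqxx; apply: natz.
Qed.

Lemma marks_delta_neq0 C : marks (delta C) C != 0.
Proof.
rewrite marks_delta -lt0n card_gt0; apply/set0Pn.
exists (conj_repr C : {set gT}).
rewrite inE -orbitRs orbit_refl -[X in X \in _]rcoset1 sub_afixRs_norms.
by rewrite conjsg1 subxx.
Qed.

(** Triangularity of the table of marks: a point of Gamma/C fixed by D gives a
    conjugate of C that contains D. *)
Lemma marks_delta_supp C D : marks (delta C) D != 0 ->
  D = C \/ (#|conj_repr D| < #|conj_repr C|)%N.
Proof.
rewrite marks_delta -lt0n card_gt0 => /set0Pn[A /setIP[/rcosetsP[x _ ->]]].
rewrite sub_afixRs_norms => sDC.
have [lt|] := ltnP #|conj_repr D| #|conj_repr C|; first by right.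
rewrite -(cardJg _ x).
move=> le; left; apply: (@conj_eq _ _ (conj_repr D)); first exact: conj_repr_in.
have eDC : conj_repr D = (conj_repr C :^ x)%G.
  by apply: val_inj => /=; apply/eqP; rewrite eqEcard sDC.
by rewrite eDC conj_repr_orbit; apply/orbitP; exists x.
Qed.

End Orbits.

(** * Positivity of total powers and of the transfer product *)

Section Effective.

Lemma gset_class_ge0 (gT : finGroupType) (T : finType)
    (to : {action gT &-> T}) S C :
  0 <= gset_class to S C.
Proof. by rewrite ffunE. Qed.

(** The structure constants of the transfer product count orbits, so they are
    nonnegative. *)
Lemma star_coef (gT : finGroupType) i j n (e : (i + j)%N = n) :
  exists2 s : Conj (wreath gT i) -> Conj (wreath gT j) ->
              Conj (wreath gT n) -> int,
    forall C D E, 0 <= s C D E &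
    forall a b E, star e a b E = \sum_C \sum_D s C D E * (a C * b D).
Proof.
eexists; last first.
  move=> a b E; rewrite /star sum_ffunE; apply: eq_bigr => C _.
  rewrite sum_ffunE; apply: eq_bigr => D _.
  have MzE (f : Burnside (wreath gT n)) (z : int) : (f *~ z) E = f E * z.
    case: z => m; first by rewrite -!pmulrn ffunMnE -mulr_natr natz.
    by rewrite NegzE -!nmulrn ffunE ffunMnE mulrN -mulr_natr natz.
  by rewrite MzE.
by move=> C D E; apply: gset_class_ge0.
Qed.

Variables (gT : finGroupType).
Variable P : forall n, Burnside gT -> Burnside (wreath gT n).
Arguments P : clear implicits.
Hypothesis P_total : is_total_power P.

(** The classes of sets satisfy this condition, and so do sums of such classes;
    asking for it directly avoids the realization of a sum as a disjoint union. *)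
Definition effective (x : Burnside gT) := forall n C, 0 <= P n x C.

(** This condition bounds the support of a by the support of a total power and,
    unlike a mere bound on supports, passes to products by monotonicity. *)
Definition subpower n (a : Burnside (wreath gT n)) :=
  exists2 x, effective x & forall C, 0 <= a C <= P n x C.

(** In the expansion of P_n(x + y) every term is nonnegative, so each of them is
    bounded by the sum. *)
Lemma powerD i j n (e : (i + j)%N = n) x y :
  exists2 r : Burnside (wreath gT n),
    (effective x -> effective y -> forall C, 0 <= r C) &
    P n (x + y) = star e (P i x) (P j y) + r.
Proof.
have [_ _ PD] := P_total; rewrite PD.
have lt_in : (i < n.+1)%N by rewrite ltnS -e leq_addr.
have ej : j = (n - i)%N by rewrite -e addKn.
rewrite (bigD1 (Ordinal lt_in)) //=; subst j.
rewrite (eq_irrelevance e (subnKC (ltn_ord (Ordinal lt_in) : (i <= n)%N))).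
eexists; last by [].
move=> x0 y0 C; rewrite sum_ffunE; apply: sumr_ge0 => k _.
have [s s0 ->] := star_coef gT (subnKC (ltn_ord k : (k <= n)%N)).
by do 2!apply: sumr_ge0 => ? _; rewrite !mulr_ge0 ?s0 ?x0 ?y0.
Qed.

Lemma effective_gset (T : finType) (to : {action gT &-> T}) (S : {set T}) :
  [acts [set: gT], on S | to] -> effective (gset_class to S).
Proof.
by move=> actS n C; have [-> // _ _] := P_total; apply: gset_class_ge0.
Qed.

Lemma effective_delta C : effective (delta C).
Proof. by rewrite -coset_delta; apply/effective_gset/actsRs_rcosets. Qed.

Lemma effectiveD x y : effective x -> effective y -> effective (x + y).
Proof.
move=> x0 y0 n C; have [r r0 ->] := powerD (add0n n) x y.
rewrite ffunE addr_ge0 ?r0 //; have [s s0 ->] := star_coef gT (add0n n).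
by do 2!apply: sumr_ge0 => ? _; rewrite !mulr_ge0 ?s0 ?x0 ?y0.
Qed.

Lemma subpower_power n x : effective x -> subpower (P n x).
Proof. by move=> x0; exists x => // C; rewrite x0 lexx. Qed.

(** Bounds P_i(x) on a and P_j(y) on b give the bound star (P_i x) (P_j y) on the
    product, which is in turn bounded by P_n(x + y). *)
Lemma subpower_star i j n (e : (i + j)%N = n) (a : Burnside (wreath gT i))
    (b : Burnside (wreath gT j)) :
  subpower a -> subpower b -> subpower (star e a b).
Proof.
move=> [x x0 ax] [y y0 by_]; exists (x + y); first exact: effectiveD.
move=> E; have [r r0 ->] := powerD e x y; rewrite ffunE.
have [s s0 sE] := star_coef gT e; rewrite !sE.
apply/andP; split.
  apply: sumr_ge0 => C _; apply: sumr_ge0 => D _.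
  have /andP[a0 _] := ax C; have /andP[b0 _] := by_ D.
  by rewrite !mulr_ge0 ?s0.
rewrite -[leLHS]addr0 lerD ?r0 //.
apply: ler_sum => C _; apply: ler_sum => D _; apply: ler_wpM2l; first exact: s0.
have /andP[a0 aC] := ax C; have /andP[b0 bD] := by_ D.
exact: ler_pM.
Qed.

Lemma subpower_in_Aring n (a : Burnside (wreath gT n)) :
  subpower a -> in_Aring P a.
Proof.
move=> [x _ ax] B sB C; have /andP[a0 aP] := ax C.
rewrite neq_lt ltNge a0 /= => aC; apply: (sB x).
by rewrite gt_eqF // (lt_le_trans aC).
Qed.

Lemma power_in_Aring n x : in_Aring P (P n x).
Proof. by move=> B; apply. Qed.

End Effective.

(** * Parks of products of total powers span *)

Section Monomials.

Lemma monomial_scale (R : nzRingType) (K : choiceType) k (mu : K) :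
  << k *g mu >> = k *: << mu >> :> {malg R[K]}.
Proof. by apply/malgP => nu; rewrite mcoeffZ !mcoeffU mulrnAr mulr1. Qed.

Lemma monomialE (K : choiceType) (mu nu : K) :
  (<< mu >> : {malg rat[K]})@_nu = (mu == nu)%:R.
Proof. exact: mcoeffU. Qed.

Lemma isolate_monomial (K : choiceType) (f : {malg rat[K]}) (mu : K) :
  f@_mu != 0 ->
  << mu >> =
    (f@_mu)^-1 *: (f - \sum_(nu <- msupp f | nu != mu) << f@_nu *g nu >>).
Proof.
move=> f_mu; rewrite {2}(monalgE f) (bigD1_seq mu) ?fset_uniq -?mcoeff_neq0 //=.
by rewrite addrK (monomial_scale f@_mu) scalerA mulVf // scale1r.
Qed.

End Monomials.

Section PowerSpan.

Variable gT : finGroupType.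
Variable P : forall n, Burnside gT -> Burnside (wreath gT n).
Arguments P : clear implicits.
Hypothesis P_total : is_total_power P.

Inductive power_product : forall n, Burnside (wreath gT n) -> Prop :=
| PowerFactor n x of effective P x : power_product (P n x)
| PowerStar i j n (e : (i + j)%N = n) a b of
    power_product a & power_product b : power_product (star e a b).

Lemma power_product_Aring n (a : Burnside (wreath gT n)) :
  power_product a -> in_Aring P a.
Proof.
move=> pa; apply: subpower_in_Aring.
elim: {n a} pa => [n x|i j n e a b _ sa _ sb].
  exact: subpower_power.
exact: subpower_star.
Qed.

Variable chi : forall n, Burnside (wreath gT n) -> Parks gT int.
Arguments chi : clear implicits.
Hypothesis chi_hom : is_parks_hom P chi.

Lemma chi_power n x (c : Comp (Conj gT)) :
  (chi n (P n x))@_(comp_part c) =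
    if (\sum_(p <- c) val p.2)%N == n then \prod_(p <- c) marks x p.1 else 0.
Proof.
have [chi_gr _ _ _ chiP] := chi_hom; rewrite -part_size_comp.
have [sz|] := eqVneq; last first.
  apply: contra_neq_eq; apply: chi_gr; exact: power_in_Aring.
rewrite chiP // -[RHS]big_part; apply: eq_bigr => p _.
by rewrite Monoid.iteropE iter_mulr_1.
Qed.

Lemma parksQE (f : Parks gT int) mu : (parksQ f)@_mu = (f@_mu)%:~R.
Proof. by rewrite mcoeffE; case: msuppP. Qed.

Lemma parksQ_star i j n (e : (i + j)%N = n) a b c :
  in_Aring P a -> in_Aring P b ->
  (parksQ (chi n (star e a b)))@_(comp_part c) =
    deal_prod (fun d => (parksQ (chi i a))@_(comp_part d))
              (fun d => (parksQ (chi j b))@_(comp_part d)) c.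
Proof.
move=> Aa Ab; have [_ _ _ chiS _] := chi_hom.
rewrite parksQE chiS // parks_star_deal.
rewrite rmorph_sum /=; apply: eq_bigr => p _.
by rewrite !parksQE rmorphM.
Qed.

Inductive power_span : Parks gT rat -> Prop :=
| PowerSpanProduct n a of power_product a : power_span (parksQ (chi n a))
| PowerSpan0 : power_span 0
| PowerSpanLin k f g of power_span f & power_span g : power_span (k *: f + g).

(** The span of a set closed under products is closed under products. *)
Lemma power_span_star f g : power_span f -> power_span g ->
  exists2 h, power_span h & forall c, h@_(comp_part c) =
    deal_prod (fun d => f@_(comp_part d)) (fun d => g@_(comp_part d)) c.
Proof.
elim=> {f} [i a pa||k f1 f2 _ IH1 _ IH2] sg; last 2 first.
- exists 0 => [|c]; first exact: PowerSpan0.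
  by rewrite mcoeff0 /deal_prod big1 // => p _; rewrite mcoeff0 mul0r.
- have [[h1 s1 e1] [h2 s2 e2]] := (IH1 sg, IH2 sg).
  exists (k *: h1 + h2) => [|c]; first exact: PowerSpanLin.
  rewrite mcoeffD mcoeffZ e1 e2 /deal_prod mulr_sumr -big_split /=.
  by apply: eq_bigr => p _; rewrite mcoeffD mcoeffZ mulrDl mulrA.
elim: sg => {g} [j b pb||k g1 g2 _ [h1 s1 e1] _ [h2 s2 e2]].
- exists (parksQ (chi (i + j) (star erefl a b))) => [|c].
    by apply: PowerSpanProduct; apply: PowerStar.
  by apply: parksQ_star; apply: power_product_Aring.
- exists 0 => [|c]; first exact: PowerSpan0.
  by rewrite mcoeff0 /deal_prod big1 // => p _; rewrite mcoeff0 mulr0.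
- exists (k *: h1 + h2) => [|c]; first exact: PowerSpanLin.
  rewrite mcoeffD mcoeffZ e1 e2 /deal_prod mulr_sumr -big_split /=.
  by apply: eq_bigr => p _; rewrite mcoeffD mcoeffZ mulrDr mulrCA.
Qed.

Lemma power_spanZ k f : power_span f -> power_span (k *: f).
Proof.
by move=> sf; rewrite -[_ *: _]addr0; apply: PowerSpanLin PowerSpan0.
Qed.

Lemma power_spanD f g : power_span f -> power_span g -> power_span (f + g).
Proof. by move=> sf sg; rewrite -[f]scale1r; apply: PowerSpanLin. Qed.

Lemma power_span_unit : power_span << mset0 >>.
Proof.
have eff1 : effective P (Burnside1 gT).
  by apply: effective_gset => //; apply/actsP.
have [_ P0 _] := P_total; have [_ _ chi1 _ _] := chi_hom.
have := PowerSpanProduct (PowerFactor 0 eff1); congr power_span.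
apply/malgP => mu; rewrite parksQE P0 chi1 mcoeffU eq_sym.
by case: eqP.
Qed.

(** At a partition mu, the star product of the basis parks at [mset q] and at
    comp_part c counts the deals of mu into these two, so it is concentrated at
    their sum. Its value there is a positive integer, by which one divides. *)
Lemma power_span_cons q (c : Comp (Conj gT)) :
  power_span << [mset q]%mset >> -> power_span << comp_part c >> ->
  power_span << comp_part (q :: c) >>.
Proof.
move=> sq sc; have [h sh hE] := power_span_star sq sc.
pose N : nat := count_mem ([mset q]%mset, comp_part c)
  [seq deal_parts p | p <- deals (q :: c)].
have N0 : N%:R != 0 :> rat.
  rewrite pnatr_eq0; apply/eqP => N0.
  have := count_deals_parts (esym (comp_part_cons q c)).
  by rewrite -/N N0 mul0n => /esym/eqP; rewrite -leqn0 leqNgt part_fact_gt0.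
rewrite (_ : << _ >> = N%:R^-1 *: h); first exact: power_spanZ.
apply/malgP => mu; have [d ->] := part_enum mu; rewrite mcoeffZ hE.
apply: (mulfI N0); rewrite mulVKf //.
have -> : deal_prod (fun d => << [mset q]%mset >>@_(comp_part d))
     (fun d => << comp_part c >>@_(comp_part d)) d =
     (count_mem ([mset q]%mset, comp_part c)
        [seq deal_parts p | p <- deals d])%:R :> rat.
  rewrite -sum1_count natr_sum big_map [RHS]big_mkcond.
  apply: eq_bigr => p _ /=; rewrite !monomialE /deal_parts xpair_eqE.
  rewrite [comp_part p.1 == _]eq_sym [comp_part p.2 == _]eq_sym.
  by do 2![case: eqP => _ //=]; rewrite ?mulr1 ?mulr0 ?mul0r.
rewrite monomialE; have [e|ne] := eqVneq.
  have := count_deals_parts (etrans (esym (comp_part_cons q c)) e).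
  have := count_deals_parts (esym (comp_part_cons q c)).
  rewrite -/N e => <- /eqP.
  by rewrite eqn_pmul2r ?muln_gt0 ?part_fact_gt0 // => /eqP ->; rewrite mulr1.
rewrite mulr0; apply/esym/eqP; rewrite pnatr_eq0.
rewrite -leqn0 leqNgt -has_count has_pred1; apply/mapP => -[p /mem_deals e1 e2].
by case/eqP: ne; rewrite comp_part_cons -e1; case: e2 => -> ->.
Qed.

Lemma power_span_comp (c : Comp (Conj gT)) :
  (forall q, q \in c -> power_span << [mset q]%mset >>) ->
  power_span << comp_part c >>.
Proof.
elim: c => [_|q c IHc sc].
  by rewrite comp_part_nil; apply: power_span_unit.
apply: power_span_cons; first by apply: sc; apply: mem_head.
by apply: IHc => p pc; apply: sc; rewrite inE pc orbT.
Qed.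

(** By induction on m, then on the order of the subgroups in C. The park of
    P_m([Gamma/C]) is not zero at (C, m), and every other partition mu in its
    support is handled by induction: either mu has at least two parts, which are
    then smaller than m, or mu is a single part (K, m) such that [Gamma/C] has
    points fixed by K. *)
Lemma power_span_one_part (C : Conj gT) (m : posnat) :
  power_span << [mset (C, m)]%mset >>.
Proof.
have [w] := ubnP (val m); elim: w m C => // w IHw m C.
have [v] := ubnP #|conj_repr C|; elim: v C => // v IHv C leCv lemw.
pose f := parksQ (chi (val m) (P (val m) (delta C))).
pose la := [mset (C, m)]%mset : Parts gT.
have fE c : f@_(comp_part c) = if (\sum_(p <- c) val p.2)%N == val m
    then (\prod_(p <- c) marks (delta C) p.1)%:~R else 0.
  by rewrite parksQE chi_power; case: ifP.
have f_la : f@_la != 0.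
  by rewrite /la -comp_part1 fE !big_seq1 eqxx intr_eq0 marks_delta_neq0.
have sf : power_span f by apply/PowerSpanProduct/PowerFactor/effective_delta.
have sg : power_span (\sum_(mu <- msupp f | mu != la) << f@_mu *g mu >>).
  rewrite big_seq_cond; apply: big_ind => [||mu /andP[]].
  - exact: PowerSpan0.
  - exact: power_spanD.
  rewrite -mcoeff_neq0 monomial_scale => + mula; have [c e] := part_enum mu.
  move: mula; rewrite {}e fE => cla.
  case: (eqVneq (\sum_(p <- c) val p.2)%N (val m)) => [szc|_]; last first.
    by rewrite eqxx.
  rewrite intr_eq0 => mkc.
  apply/power_spanZ/power_span_comp => -[K k] Kk.
  move: cla szc mkc Kk; case: c => [|[K' m'] [|r c]].
  - by rewrite in_nil.
  - rewrite comp_part1 !big_seq1 /= => + /val_inj e +.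
    rewrite e inE => + + /eqP[-> ->].
    move=> neq /marks_delta_supp[eK|lt]; first by rewrite eK eqxx in neq.
    by apply: IHv => //; apply: leq_trans lt _.
  have: (1 < size [:: (K', m'), r & c])%N by [].
  (* A proper part of a partition of m is smaller than m. *)
  move: [:: _, r & c] => l lt1l _ szc _ Kk.
  apply: IHw; rewrite -ltnS; apply: leq_trans lemw.
  rewrite ltnS -szc (big_rem _ Kk) /= -[X in (X < _)%N]addn0 ltn_add2l.
  have := size_rem Kk.
  case: (rem _ _) => [|p s _]; first by case: (size l) lt1l => [|[]].
  by rewrite big_cons addn_gt0 (valP p.2).
rewrite (isolate_monomial f_la); apply: power_spanZ.
by rewrite addrC -scaleN1r; apply: PowerSpanLin.
Qed.

Lemma power_span_full f : power_span f.
Proof.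
rewrite (monalgE f); apply: big_ind => [||mu _]; last 1 first.
- rewrite monomial_scale; apply: power_spanZ.
  have [c ->] := part_enum mu; apply: power_span_comp => -[C m] _.
  exact: power_span_one_part.
- exact: PowerSpan0.
- exact: power_spanD.
Qed.

End PowerSpan.

(** * Sums over compositions and partitions *)

Lemma sum_fibres (K : choiceType) (I : eqType) (u : I -> K) (s : seq I)
    (E : I -> rat) (G : K -> rat) :
  \sum_(k <- undup [seq u i | i <- s]) (\sum_(i <- s | u i == k) E i) * G k =
    \sum_(i <- s) G (u i) * E i.
Proof.
under eq_bigr do rewrite big_mkcond mulr_suml.
rewrite exchange_big; apply: eq_big_seq => i si.
rewrite (bigD1_seq (u i)) ?undup_uniq ?mem_undup ?map_f //= eqxx mulrC.
by rewrite big1 ?addr0 // => k; rewrite eq_sym => /negPf ->; rewrite mul0r.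
Qed.

Section CompositionSums.

Variables (hT gT : finGroupType) (M : Conj gT -> Conj hT -> rat).

Implicit Types (c : Comp (Conj gT)) (l : Comp (Conj hT)) (f : Parks hT rat).

Lemma sum_colourings (s : seq posnat) (E : Comp (Conj hT) -> rat)
    (D : pred (Comp (Conj hT))) :
  \sum_(l \in [set l | D l /\ comp_sharp l = s]%classic) E l =
    \sum_(l <- colourings (Conj hT) s | D l) E l.
Proof.
rewrite -[RHS]big_filter.
rewrite (_ : [set l | _]%classic =
             [set` filter D (colourings (Conj hT) s)]%classic).
  by rewrite -fsbig_seq // filter_uniq ?colourings_uniq.
apply/seteqP; split=> l /=; rewrite mem_filter mem_colourings.
  by case=> -> ->; rewrite eqxx.
by case/andP => -> /eqP.
Qed.

Lemma recolour_sum f c :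
  recolour M (fun l => f@_(comp_part l)) c =
  \sum_(l \in [set l | comp_sharp l = comp_sharp c]%classic)
    f@_(comp_part l) * comp_coef M c l.
Proof.
rewrite /recolour -(sum_colourings _ _ predT); apply: eq_fsbigl.
by apply/seteqP; split=> l /=; [case | split].
Qed.

(** Grouping the recolourings of c by the partition that they represent. Any
    index set D containing these partitions gives the same sum, because the
    coefficients at all other partitions are empty sums. *)
Lemma parks_coef_sum f c (D : set (Parts hT)) :
  (forall l, comp_sharp l = comp_sharp c -> D (comp_part l)) ->
  recolour M (fun l => f@_(comp_part l)) c =
  \sum_(la \in D) parks_coef M c la * f@_la.
Proof.
move=> sD; pose s := colourings (Conj hT) (comp_sharp c).
have coefE la :
    parks_coef M c la = \sum_(l <- s | comp_part l == la) comp_coef M c l.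
  rewrite -(sum_colourings _ _ (fun l => comp_part l == la)); apply: eq_fsbigl.
  by apply/seteqP; split=> l /= [/eqP ? ?].
have mem_s l : l \in s -> comp_sharp l = comp_sharp c.
  by rewrite mem_colourings => /eqP.
rewrite /recolour -/s -(sum_fibres (@comp_part _) s).
rewrite fsbig_seq ?undup_uniq //.
under eq_fsbigr do rewrite -coefE.
apply: fsbig_widen => la /=.
  by rewrite mem_undup => /mapP[l ls ->]; apply/sD/mem_s.
case=> _ la_s; rewrite coefE big_seq_cond big1 ?mul0r // => l /andP[ls /eqP ul].
by case: la_s; rewrite mem_undup -ul map_f.
Qed.

End CompositionSums.

Theorem theorem14p2 (hT gT : finGroupType)
    (F : {additive Burnside hT -> Burnside gT})
    (PH : forall n, Burnside hT -> Burnside (wreath hT n))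
    (PG : forall n, Burnside gT -> Burnside (wreath gT n))
    (chiH : forall n, Burnside (wreath hT n) -> Parks hT int)
    (chiG : forall n, Burnside (wreath gT n) -> Parks gT int)
    (Fo : forall n, Burnside (wreath hT n) -> Burnside (wreath gT n))
    (FM : {linear Marks hT rat -> Marks gT rat})
    (FP : {linear Parks hT rat -> Parks gT rat})
    (M : Conj gT -> Conj hT -> rat)
    (c : Parts gT -> Comp (Conj gT)) :
  is_total_power PH -> is_total_power PG ->
  is_parks_hom PH chiH -> is_parks_hom PG chiG ->
  is_induced_hom F PH PG Fo ->
  is_marks_map F FM -> is_marks_coef FM M ->
  is_parks_map PH Fo chiH chiG FP ->
  (forall kappa, comp_part (c kappa) = kappa) ->
  forall (f : Parks hT rat) (kappa : Parts gT),
  [/\ (FP f)@_kappa =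
        \sum_(la \in [set: Parts hT]%classic)
          parks_coef M (c kappa) la * f@_la,
      (FP f)@_kappa =
        \sum_(la \in [set la : Parts hT |
                       part_sharp la = part_sharp kappa]%classic)
          parks_coef M (c kappa) la * f@_la &
      (FP f)@_kappa =
        \sum_(l \in [set l : Comp (Conj hT) |
                      comp_sharp l = comp_sharp (c kappa)]%classic)
          f@_(comp_part l) * comp_coef M (c kappa) l].
Proof.
move=> PH_total PG_total chiH_hom chiG_hom Fo_hom FM_map M_coef FP_map c_part.
move=> f kappa.
have [FoA _ _ FoS FoP] := Fo_hom.
(* A recolouring keeps the sizes of the entries, so recolouring respects the
   condition that the total size is n. *)
have power_case n x d : (parksQ (chiG n (PG n (F x))))@_(comp_part d) =
    recolour M (fun l => (parksQ (chiH n (PH n x)))@_(comp_part l)) d.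
  rewrite parksQE (chi_power chiG_hom).
  transitivity (if (\sum_(p <- d) val p.2)%N == n then
      recolour M (fun l => \prod_(p <- l) marksQ x p.1) d else 0).
    case: ifP => // _; rewrite rmorph_prod recolour_prod; apply: eq_bigr => p _.
    by rewrite -M_coef FM_map [RHS]ffunE.
  have szE (X : finType) (l : Comp X) :
      (\sum_(p <- l) val p.2 = \sum_(m <- comp_sharp l) val m)%N.
    by rewrite big_map.
  transitivity (\sum_(l <- colourings (Conj hT) (comp_sharp d))
      (if (\sum_(p <- d) val p.2)%N == n
       then \prod_(p <- l) marksQ x p.1 else 0)
        * \prod_(p <- zip d l) M p.1.1 p.2.1).
    by case: ifP => // _; rewrite big1 // => l _; rewrite mul0r.
  apply: eq_big_seq => l; rewrite mem_colourings => /eqP e.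
  rewrite parksQE (chi_power chiH_hom) !szE e; case: ifP => // _.
  rewrite rmorph_prod; congr (_ * _).
  by apply: eq_bigr => p _; rewrite [LHS]ffunE.
have product_case n a d : power_product PH a ->
    (parksQ (chiG n (Fo n a)))@_(comp_part d) =
    recolour M (fun l => (parksQ (chiH n a))@_(comp_part l)) d.
  move=> pa; elim: pa d => {n a} [n x _ d|i j n e a b pa IHa pb IHb d].
    by rewrite FoP power_case.
  have Aa := power_product_Aring PH_total pa.
  have Ab := power_product_Aring PH_total pb.
  rewrite FoS // (parksQ_star chiG_hom); [|exact: FoA|exact: FoA].
  rewrite (eq_deal_prod IHa IHb) -recolour_deal; apply: eq_recolour => l.
  by rewrite (parksQ_star chiH_hom).
have FP_recolour d :
    (FP f)@_(comp_part d) = recolour M (fun l => f@_(comp_part l)) d.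
  elim: (power_span_full PH_total chiH_hom f) => [n a pa||k g h _ IHg _ IHh].
  - by rewrite FP_map ?product_case //; apply: (power_product_Aring PH_total).
  - by rewrite linear0 mcoeff0 /recolour big1 // => l _; rewrite mcoeff0 mul0r.
  rewrite linearP mcoeffD mcoeffZ IHg IHh -recolour_lin.
  by apply: eq_recolour => l; rewrite mcoeffD mcoeffZ.
rewrite -[kappa in (FP f)@_kappa]c_part FP_recolour; split.
- exact: parks_coef_sum.
- apply: parks_coef_sum => l e /=; rewrite -(c_part kappa).
  exact: part_sharp_eq.
exact: recolour_sum.
Qed.
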